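(* Suppose the AMDP is unregularized, i.e. $\omega=0$ and $h^\pi$ is $L$-Lipschitz with $L=0$, and suppose the critic-error assumption holds with constants $\varsigma\ge 0$, $\sigma\ge0$, $\kappa>0$. Fix an integer $K\ge 1$ and run the SPMD algorithm with $\lambda_k=\lambda=\frac{2\sqrt{\log|\mathcal A|}}{\kappa\sqrt K}$. Then $$\mathbb E\Big[\sum_{k=0}^{K-1}\big(\rho(\pi_k)-\rho(\pi^* )\big)\Big]\le \kappa\sqrt{K\log|\mathcal A|}+K\varsigma .$$ Moreover, if $r$ is chosen uniformly from $\{0,1,\dots,K-1\}$, then $$\mathbb E[\rho(\pi_r)-\rho(\pi^* )]\le \frac{\kappa\sqrt{\log|\mathcal A|}}{\sqrt K}+\varsigma .$$
   Context: **AMDP.** An average-reward Markov decision process has a finite state space $\mathcal S$, a finite action space $\mathcal A$, a transition kernel $\mathsf P(s'|s,a)$ and a cost $c:\mathcal S\times\mathcal A\to\mathbb R$. A policy $\pi$ assigns to each $s\in\mathcal S$ a distribution $\pi(\cdot|s)\in\Delta_{|\mathcal A|}$. Write $P_\pi(s,s')=\sum_a\pi(a|s)\mathsf P(s'|s,a)$ and $c^\pi(s)=\sum_a c(s,a)\pi(a|s)$. Standing (mixing) assumption: every policy $\pi$ has a stationary distribution $\nu^\pi$ and $t_{\mathrm{mix}}:=\max_\pi\min\{t\ge1:\max_{q\in\Delta_{|\mathcal S|}}\|((P_\pi)^t)^\top q-\nu^\pi\|_1\le\frac12\}<\infty$. **Regularizer and Bregman distance.** $D_{\pi'}^{\pi}(s)=\sum_a\pi(a|s)\log\frac{\pi(a|s)}{\pi'(a|s)}$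 (KL divergence). $h^\pi(s)$ is a closed convex function of $\pi(\cdot|s)$ such that, for some $\omega\ge0$, $h^\pi(s)-[h^{\pi'}(s)+\langle\nabla h^{\pi'}(s,\cdot),\pi(\cdot|s)-\pi'(\cdot|s)\rangle]\ge\omega D_{\pi'}^\pi(s)$, with $\nabla h^{\pi'}$ a subgradient. $L$-Lipschitz means $|h^\pi(s)-h^{\pi'}(s)|\le L\|\pi(\cdot|s)-\pi'(\cdot|s)\|_1$ for all $s,\pi,\pi'$. **Objective.** $\rho(\pi)=\langle\nu^\pi,c^\pi+h^\pi\rangle$ is the long-run average cost; $\pi^*$ minimizes $\rho$ over all policies. The basic differential Q-function is $\bar Q^\pi(s,a)=\mathbb E_\pi[\sum_{t\ge0}(c(s_t,a_t)+h^\pi(s_t)-\rho(\pi))\mid s_0=s,a_0=a]$. **SPMD algorithm.** Start from $\pi_0(a|s)=1/|\mathcal A|$. At iteration $k=0,1,\dots$: compute from random samples $\zeta_k$ an estimator $\mathcal Q^{\pi_k,\zeta_k}\in\mathbb R^{|\mathcal S||\mathcal A|}$ of $\bar Q^{\pi_k}$; then for every $s\in\mathcal S$ set $$\pi_{k+1}(\cdot|s)=\arg\min_{p(\cdot|s)\in\Delta_{|\mathcal A|}}\{\lambda_k[\langle\mathcal Q^{\pi_k,\zeta_k}(s,\cdot),p(\cdot|s)\rangle+h^p(s)]+D_{\pi_k}^p(s)\}.$$ **Critic-error assumption.** Let $\|x\|_{\mathrm{sp}}=\max_i x_i-\min_i x_i$, and let $\mathbb E_{\zeta_k}$ denote expectation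 over $\zeta_k$ conditionally on $\zeta_0,\dots,\zeta_{k-1}$. There are $\varsigma,\sigma,\kappa\ge0$ such that for every $k\ge0$: $\|\mathbb E_{\zeta_k}[\mathcal Q^{\pi_k,\zeta_k}]-\bar Q^{\pi_k}\|_{\mathrm{sp}}\le\varsigma$, $\mathbb E_{\zeta_k}[\|\mathcal Q^{\pi_k,\zeta_k}-\bar Q^{\pi_k}\|_{\mathrm{sp}}^2]\le\sigma^2$, and $\mathbb E_{\zeta_k}[\|\mathcal Q^{\pi_k,\zeta_k}\|_{\mathrm{sp}}^2]\le\kappa^2$. *)

(* Defs.v *)
From HB Require Import structures.
From mathcomp Require Import all_boot all_order all_algebra.
From mathcomp Require Import all_classical all_reals all_analysis.

Set Implicit Arguments.
Unset Strict Implicit.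
Unset Printing Implicit Defensive.

Import Order.TTheory GRing.Theory Num.Theory.
Import numFieldNormedType.Exports.

Local Open Scope classical_set_scope.
Local Open Scope ring_scope.

Section Finite.
Context {R : realType}.

Definition simplex {T : finType} : set (T -> R) :=
  [set p | (forall x, 0 <= p x) /\ \sum_x p x = 1].

Definition l1 (T : finType) (x : T -> R) : R := \sum_i `|x i|.

(* On a nonempty finite index type the range is finite, so sup and inf are
   attained: this is max_i x_i - min_i x_i. *)
Definition span_seminorm (T : finType) (x : T -> R) : R :=
  sup (range x) - inf (range x).

(* D_{p'}^{p}.  Over the extended reals, because ln 0 = 0 and x / 0 = 0 in the
   library: a real-valued sum would be finite when p is not absolutely
   continuous with respect to p'. *)
Definition KL (T : finType) (p p' : T -> R) : \bar R :=
  (\sum_(x : T) if p x == 0%R then 0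
                else if p' x == 0%R then +oo
                else (p x * ln (p x / p' x))%:E)%E.

End Finite.

Section AMDP.
Context {R : realType} {S A : finType}.

Definition policy : set (S -> A -> R) := [set pi | forall s, simplex (pi s)].

Definition is_kernel (P : S -> A -> S -> R) : Prop :=
  forall s a, simplex (P s a).

Definition policy_kernel (P : S -> A -> S -> R) (pi : S -> A -> R)
  (s s' : S) : R := \sum_a pi s a * P s a s'.

Definition policy_cost (c : S -> A -> R) (pi : S -> A -> R) (s : S) : R :=
  \sum_a c s a * pi s a.

Fixpoint kernel_pow (M : S -> S -> R) (t : nat) (s s' : S) : R :=
  if t is t'.+1 then \sum_u M s u * kernel_pow M t' u s' else (s == s')%:R.

Definition stationary (M : S -> S -> R) (nu : S -> R) : Prop :=
  simplex nu /\ forall s', \sum_s nu s * M s s' = nu s'.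

Definition mixing_times (M : S -> S -> R) (nu : S -> R) : set nat :=
  [set t | (1 <= t)%N /\
    forall q, simplex q ->
      l1 (fun s' => \sum_s q s * kernel_pow M t s s' - nu s') <= 2^-1].

(* Extended-real valued, with inf(empty) = +oo; when it is finite it is a
   supremum of a bounded set of integers, hence a maximum. *)
Definition tmix (P : S -> A -> S -> R) (nu : (S -> A -> R) -> S -> R) : \bar R :=
  ereal_sup [set ereal_inf [set (t%:R)%:E |
               t in mixing_times (policy_kernel P pi) (nu pi)]
            | pi in policy].

(* h s p is the value at s of h^pi for any policy with pi(.|s) = p. *)
Definition lipschitz_regularizer (h : S -> (A -> R) -> R) (L : R) : Prop :=
  forall s (pi pi' : S -> A -> R), policy pi -> policy pi' ->
    `|h s (pi s) - h s (pi' s)| <= L * l1 (fun a => pi s a - pi' s a).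

Definition subgradient (f : (A -> R) -> R) (p' g : A -> R) : Prop :=
  forall p, simplex p -> f p' + \sum_a g a * (p a - p' a) <= f p.

Definition regularizer (h : S -> (A -> R) -> R) (omega : R) : Prop :=
  forall s,
  [/\ closed [set z : {ptws A -> R} * R | simplex z.1 /\ h s z.1 <= z.2],
      convex_function (simplex : set (convex_lmodType (A -> R^o))) (h s) &
      forall p p' g, simplex p -> simplex p' -> subgradient (h s) p' g ->
        (omega%:E * KL p p' <=
         (h s p - (h s p' + \sum_a g a * (p a - p' a)))%:E)%E].

Definition avg_cost (c : S -> A -> R) (h : S -> (A -> R) -> R)
  (nu : (S -> A -> R) -> S -> R) (pi : S -> A -> R) : R :=
  \sum_s nu pi s * (policy_cost c pi s + h s (pi s)).

Definition optimal_policy (c : S -> A -> R) (h : S -> (A -> R) -> R)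
  (nu : (S -> A -> R) -> S -> R) (pistar : S -> A -> R) : Prop :=
  policy pistar /\
  forall pi, policy pi -> avg_cost c h nu pistar <= avg_cost c h nu pi.

(* The law of (s_t, a_t) under pi, started from (s_0, a_0) = (s, a). *)
Fixpoint state_action_law (P : S -> A -> S -> R) (pi : S -> A -> R)
  (s : S) (a : A) (t : nat) (y : S * A) : R :=
  if t is t'.+1 then
    \sum_(x : S * A) state_action_law P pi s a t' x * P x.1 x.2 y.1 * pi y.1 y.2
  else (y == (s, a))%:R.

(* The infinite sum inside the expectation does not converge pathwise: the
   value is the limit over T of the expectation of the sum over t < T, taken
   term by term. *)
Definition diff_Q (P : S -> A -> S -> R) (c : S -> A -> R)
  (h : S -> (A -> R) -> R) (nu : (S -> A -> R) -> S -> R)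
  (pi : S -> A -> R) (s : S) (a : A) : R :=
  limn (series (fun t => \sum_(y : S * A) state_action_law P pi s a t y *
    (c y.1 y.2 + h y.1 (pi y.1) - avg_cost c h nu pi))).

(* p minimizes over the simplex the objective of the update at a state where
   the critic is q, the current policy is p0 and the regularizer is f. *)
Definition is_prox (lam : R) (q : A -> R) (f : (A -> R) -> R) (p0 p : A -> R) :
  Prop :=
  simplex p /\
  forall p', simplex p' ->
    ((lam * (\sum_a q a * p a + f p))%:E + KL p p0 <=
     (lam * (\sum_a q a * p' a + f p'))%:E + KL p' p0)%E.

Definition spmd_run (Omega : Type) (h : S -> (A -> R) -> R) (lam : nat -> R)
  (pi Q : nat -> Omega -> S -> A -> R) : Prop :=
  (forall w s a, pi 0%N w s a = #|A|%:R^-1) /\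
  forall k w s, is_prox (lam k) (Q k w s) (h s) (pi k w s) (pi k.+1 w s).

End AMDP.

Section Probability.
Context {R : realType} {d : measure_display} {Omega : measurableType d}.

(* The sigma-algebra generated by zeta_0, ..., zeta_(k-1). *)
Definition history {d' : measure_display} {Z : measurableType d'}
  (zeta : nat -> Omega -> Z) (k : nat) : set (set Omega) :=
  g_sigma_preimage (fun i : 'I_k => zeta i).

(* Y is a version of the conditional expectation of the integrable random
   variable X with respect to the sub-sigma-algebra F. *)
Definition is_cond_exp (Pr : probability Omega R) (F : set (set Omega))
  (X Y : Omega -> R) : Prop :=
  [/\ Pr.-integrable setT (EFin \o X), Pr.-integrable setT (EFin \o Y),
      measurable_fun (setT : set (g_sigma_algebraType F)) Y &
      forall B, F B ->
        (\int[Pr]_(w in B) (Y w)%:E = \int[Pr]_(w in B) (X w)%:E)%E].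

Definition critic_error {S A : finType} {d' : measure_display}
  {Z : measurableType d'} (Pr : probability Omega R)
  (zeta : nat -> Omega -> Z) (Q Qbar : nat -> Omega -> S -> A -> R)
  (varsigma sigma kappa : R) : Prop :=
  forall k,
  [/\ exists m : S * A -> Omega -> R,
        (forall x, is_cond_exp Pr (history zeta k)
                     (fun w => Q k w x.1 x.2) (m x)) /\
        {ae Pr, forall w,
           span_seminorm (fun x => m x w - Qbar k w x.1 x.2) <= varsigma},
      exists m : Omega -> R,
        is_cond_exp Pr (history zeta k)
          (fun w => span_seminorm
             (fun x : S * A => Q k w x.1 x.2 - Qbar k w x.1 x.2) ^+ 2) m /\
        {ae Pr, forall w, m w <= sigma ^+ 2} &
      exists m : Omega -> R,
        is_cond_exp Pr (history zeta k)
          (fun w => span_seminorm (fun x : S * A => Q k w x.1 x.2) ^+ 2) m /\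
        {ae Pr, forall w, m w <= kappa ^+ 2}].

(* r is uniform on {0, ..., K-1} and independent of the sub-sigma-algebra F. *)
Definition uniform_independent_index (Pr : probability Omega R)
  (F : set (set Omega)) (K : nat) (r : Omega -> 'I_K) : Prop :=
  forall j, [/\ measurable (r @^-1` [set j]),
    Pr (r @^-1` [set j]) = (K%:R^-1)%:E &
    forall B, F B ->
      Pr (r @^-1` [set j] `&` B) = (Pr (r @^-1` [set j]) * Pr B)%E].

End Probability.

(* Main.v *)
Require Import Defs.
From mathcomp Require Import all_boot all_order all_algebra.
From mathcomp Require Import all_classical all_reals all_analysis.
From mathcomp Require Import measurable_realfun lra ring.

Set Implicit Arguments.
Unset Strict Implicit.
Unset Printing Implicit Defensive.

Import Order.TTheory GRing.Theory Num.Theory.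
Import numFieldNormedType.Exports.

Local Open Scope classical_set_scope.
Local Open Scope ring_scope.

(** Mixing makes the series defining the differential Q-function absolutely
    convergent, so it satisfies the Bellman equation; averaging that equation
    over the stationary law nu* of the optimal policy gives
    rho(pi) - rho(pi* ) = <nu*, Q^pi, pi - pi*>.
    Since h is constant on the simplex, the update is the multiplicative-weights
    step pi_(k+1) ~ pi_k exp(- lam Q_k).  Its regret telescopes in
    KL(pi*, pi_k), up to an error lam^2 ||Q_k||_sp^2 / 4 per step that comes from
    KL(p, q) >= sum (sqrt p - sqrt q)^2.  As pi_k depends only on the past, the
    estimator may be replaced in expectation by its conditional mean, which is
    within varsigma of the true Q-function. *)

(** * Multiplicative weights *)

Section MirrorStep.
Context {R : realType} {A : finType}.
Implicit Types p q x : A -> R.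

(** Real-valued, so that [lra] and finite sums apply. It agrees with [KL] when [q] is positive
    everywhere, and zeros of [p] contribute 0. *)
Definition kl p q : R := \sum_a p a * ln (p a / q a).

Lemma KL_EFin p q : (forall a, 0 < q a) -> KL p q = (kl p q)%:E.
Proof.
move=> q0; rewrite /KL /kl -sumEFin; apply: eq_bigr => a _.
by case: eqP => [->|_]; rewrite ?mul0r// gt_eqF.
Qed.

Lemma kl_refl p : (forall a, 0 < p a) -> kl p p = 0.
Proof. by move=> p0; rewrite /kl big1// => a _; rewrite divff ?gt_eqF// ln1 mulr0. Qed.

(** This is [ln (1 + y) <= y] at [y = sqrt b / sqrt a - 1], after writing each logarithm as twice
    that of the square root. *)
Lemma sqrt_sub_le_mul_ln (a b : R) : 0 <= a -> 0 < b ->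
  2 * a - 2 * Num.sqrt a * Num.sqrt b <= a * ln (a / b).
Proof.
rewrite le_eqVlt => /predU1P[<- _|a0 b0].
  by rewrite sqrtr0 !(mulr0, mul0r) subrr.
have sa : 0 < Num.sqrt a by rewrite sqrtr_gt0.
have sb : 0 < Num.sqrt b by rewrite sqrtr_gt0.
have /(@le_ln1Dx R) : -1 < Num.sqrt b / Num.sqrt a - 1.
  by rewrite ltrBDr addNr divr_gt0.
rewrite [1 + _]addrC subrK => lnle; rewrite !ln_div ?posrE// in lnle *.
have lnsqrt (z : R) : 0 < z -> ln z = 2 * ln (Num.sqrt z).
  by move=> z0; rewrite -{1}(sqr_sqrtr (ltW z0)) lnXn ?sqrtr_gt0// mulr_natl.
rewrite (lnsqrt _ a0) (lnsqrt _ b0).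
have -> : 2 * a - 2 * Num.sqrt a * Num.sqrt b =
    a * (2 - 2 * (Num.sqrt b / Num.sqrt a)).
  by rewrite -{1 3}(sqr_sqrtr (ltW a0)); field; rewrite gt_eqF.
by rewrite ler_wpM2l ?(ltW a0)//; lra.
Qed.

Definition bhattacharyya p q : R := \sum_a Num.sqrt (p a) * Num.sqrt (q a).

Lemma hellinger_le_kl p q : simplex p -> (forall a, 0 < q a) ->
  2 - 2 * bhattacharyya p q <= kl p q.
Proof.
move=> [p0 p1] q0; rewrite -[X in X - _]mulr1 -[X in _ * X - _]p1.
rewrite /bhattacharyya !mulr_sumr -sumrB; apply: ler_sum => a _.
by rewrite mulrA sqrt_sub_le_mul_ln.
Qed.

Lemma hellingerE p q : simplex p -> simplex q ->
  2 - 2 * bhattacharyya p q =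
  \sum_a (Num.sqrt (p a) - Num.sqrt (q a)) ^+ 2.
Proof.
move=> [p0 p1] [q0 q1]; rewrite [X in X - _](_ : 2 = \sum_a p a + \sum_a q a).
  rewrite -big_split mulr_sumr -sumrB; apply: eq_bigr => a _ /=.
  by rewrite sqrrB !sqr_sqrtr//; ring.
by rewrite p1 q1.
Qed.

Lemma kl_ge0 p q : simplex p -> simplex q -> (forall a, 0 < q a) ->
  0 <= kl p q.
Proof.
move=> sp sq q0; apply: le_trans (hellinger_le_kl sp q0).
by rewrite hellingerE//; apply: sumr_ge0 => a _; exact: sqr_ge0.
Qed.

(** The divergence dominates the squared Hellinger distance, which must then vanish term by term.
    This gives uniqueness of the minimizer in the update. *)
Lemma kl_le0_eq p q : simplex p -> simplex q -> (forall a, 0 < q a) ->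
  kl p q <= 0 -> p = q.
Proof.
move=> sp sq q0 kl0; apply/funext => a.
have /eqP : \sum_a (Num.sqrt (p a) - Num.sqrt (q a)) ^+ 2 = 0.
  apply: le_anti; rewrite -(hellingerE sp sq) (le_trans (hellinger_le_kl sp q0))//=.
  by rewrite hellingerE//; apply: sumr_ge0 => b _; exact: sqr_ge0.
rewrite psumr_eq0; last by move=> b _; exact: sqr_ge0.
move=> /allP/(_ a (mem_index_enum _)) /=.
rewrite sqrf_eq0 subr_eq0 => /eqP sqrtpq.
by rewrite -(sqr_sqrtr (sp.1 a)) -(sqr_sqrtr (sq.1 a)) sqrtpq.
Qed.

(** Each [p a] is at most 1, so each logarithm [ln (p a * #|A|)] is at most [ln #|A|]. *)
Lemma kl_uniform p : simplex p -> kl p (fun=> #|A|%:R^-1) <= ln #|A|%:R.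
Proof.
move=> [p0 p1]; rewrite -[leRHS]mul1r -[X in X * _]p1 /kl mulr_suml.
apply: ler_sum => a _.
have A0 : 0 < #|A|%:R :> R by rewrite ltr0n; apply/card_gt0P; exists a.
have := p0 a; rewrite le_eqVlt => /predU1P[<-|pa0]; first by rewrite !mul0r.
rewrite ler_wpM2l// invrK lnM ?posrE// gerDr ln_le0//.
by rewrite -p1 (bigD1 a)//= lerDl sumr_ge0.
Qed.

(* Weak Pinsker inequality in dual form, obtained from
   v (a - b) <= (sqrt a - sqrt b)^2 + v^2 (sqrt a + sqrt b)^2 / 4. *)
Lemma dual_pinsker p q x (m r : R) : simplex p -> simplex q ->
  (forall a, 0 < q a) -> (forall a, `|x a - m| <= r) ->
  \sum_a x a * (q a - p a) <= kl p q + r ^+ 2.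
Proof.
move=> sp sq q0 xr.
have [[p0 p1] [_ q1]] := (sp, sq).
(* Both distributions have mass 1, so [x] may be recentred at any [m]. *)
have -> : \sum_a x a * (q a - p a) = \sum_a (x a - m) * (q a - p a).
  under [RHS]eq_bigr do rewrite mulrBl.
  by rewrite sumrB -mulr_sumr sumrB p1 q1 subrr mulr0 subr0.
have /le_trans -> // : \sum_a (x a - m) * (q a - p a) <=
    \sum_a ((Num.sqrt (p a) - Num.sqrt (q a)) ^+ 2 + r ^+ 2 / 2 * (p a + q a)).
  apply: ler_sum => a _; set v := x a - m.
  have v2 : v ^+ 2 <= r ^+ 2.
    by rewrite -real_normK ?num_real// lerXn2r ?nnegrE// (le_trans _ (xr a)).
  rewrite -{1}(sqr_sqrtr (ltW (q0 a))) -{1}(sqr_sqrtr (p0 a)).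
  rewrite -{3}(sqr_sqrtr (ltW (q0 a))) -{3}(sqr_sqrtr (p0 a)).
  set s := Num.sqrt (p a); set t := Num.sqrt (q a).
  have sq1 := sqr_ge0 (t - s - v / 2 * (t + s)).
  have sq2 := sqr_ge0 (t - s).
  have e1 : v ^+ 2 / 4 * (t + s) ^+ 2 <= r ^+ 2 / 4 * (t + s) ^+ 2.
    by rewrite ler_wpM2r ?sqr_ge0//; lra.
  have e2 : r ^+ 2 / 4 * (t + s) ^+ 2 <= r ^+ 2 / 4 * (2 * (s ^+ 2 + t ^+ 2)).
    apply: ler_wpM2l; first by rewrite divr_ge0 ?sqr_ge0.
    lra.
  have : v * (t ^+ 2 - s ^+ 2) <= (s - t) ^+ 2 + v ^+ 2 / 4 * (t + s) ^+ 2.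
    rewrite -subr_ge0.
    have -> : (s - t) ^+ 2 + v ^+ 2 / 4 * (t + s) ^+ 2 - v * (t ^+ 2 - s ^+ 2) =
       (t - s - v / 2 * (t + s)) ^+ 2 by field.
    by [].
  lra.
rewrite big_split/= -hellingerE// -mulr_sumr big_split/= p1 q1.
by have := hellinger_le_kl sp q0; lra.
Qed.

Definition softmax (p0 x : A -> R) (a : A) : R :=
  p0 a * expR (- x a) / \sum_b p0 b * expR (- x b).

Section softmax.
Variables p0 x : A -> R.
Hypotheses (sp0 : simplex p0) (p0_gt0 : forall a, 0 < p0 a).

Let Z := \sum_b p0 b * expR (- x b).

Let Z_gt0 : 0 < Z.
Proof.
rewrite lt0r sumr_ge0 ?andbT; last by move=> b _; rewrite mulr_ge0 ?expR_ge0 ?ltW.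
apply/negP; rewrite psumr_eq0; last by move=> b _; rewrite mulr_ge0 ?expR_ge0 ?ltW.
move=> /allP all0.
have : \sum_a p0 a = 0.
  apply: big1 => a _; have /eqP := all0 a (mem_index_enum _).
  by move=> /eqP; rewrite mulf_eq0 gt_eqF//= gt_eqF// expR_gt0.
by rewrite sp0.2 => /eqP; rewrite oner_eq0.
Qed.

Lemma softmax_gt0 a : 0 < softmax p0 x a.
Proof. by rewrite divr_gt0 ?mulr_gt0 ?expR_gt0. Qed.

Lemma simplex_softmax : simplex (softmax p0 x).
Proof.
split=> [a|]; first exact/ltW/softmax_gt0.
by rewrite /softmax -mulr_suml divff// gt_eqF.
Qed.

(** Gibbs variational identity: up to the constant [ln Z], the update objective is the divergence to
    [softmax p0 x]. It yields both the closed form of the minimizer and the three-point identity of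
    mirror descent. *)
Lemma prox_kl p : simplex p ->
  \sum_a x a * p a + kl p p0 = kl p (softmax p0 x) - ln Z.
Proof.
move=> [p_ge0 p1].
rewrite /kl -[ln Z]mul1r -[X in _ - X * _]p1 mulr_suml -sumrB -big_split/=.
apply: eq_bigr => a _.
have := p_ge0 a; rewrite le_eqVlt => /predU1P[<-|pa].
  by rewrite !(mulr0, mul0r) addr0 subrr.
rewrite !ln_div ?posrE ?softmax_gt0// ?mulr_gt0 ?expR_gt0//.
rewrite lnM ?posrE ?expR_gt0// expRK; ring.
Qed.

(** Subtracting [prox_kl] at the new point from [prox_kl] at [pstar] gives the three-point identity.
    Its term [- kl (softmax p0 x) p0] absorbs the divergence in [dual_pinsker], leaving only
    [r ^+ 2]. *)
Lemma mirror_step pstar (m r : R) : simplex pstar ->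
  (forall a, `|x a - m| <= r) ->
  \sum_a x a * (p0 a - pstar a) <=
    kl pstar p0 - kl pstar (softmax p0 x) + r ^+ 2.
Proof.
move=> spstar xr.
have := prox_kl spstar; have := prox_kl simplex_softmax.
rewrite kl_refl; last exact: softmax_gt0.
have := dual_pinsker simplex_softmax sp0 p0_gt0 xr.
under eq_bigr do rewrite mulrBr.
under [X in _ -> _ -> _ -> X <= _]eq_bigr do rewrite mulrBr.
rewrite !sumrB; lra.
Qed.

(** Comparing the minimizer with the softmax itself, the constant [f] cancels and [prox_kl] forces
    the divergence between the two to be at most 0. *)
Lemma prox_softmax lam q f p : x = (fun a => lam * q a) ->
  (forall p' p'', simplex p' -> simplex p'' -> f p' = f p'') ->
  is_prox lam q f p0 p -> p = softmax p0 x.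
Proof.
move=> xE fcst [sp /(_ _ simplex_softmax)].
rewrite !KL_EFin// -!EFinD lee_fin (fcst _ _ sp simplex_softmax) !mulrDr.
have mulE p' : lam * (\sum_a q a * p' a) = \sum_a x a * p' a.
  by rewrite mulr_sumr xE; apply: eq_bigr => a _; rewrite mulrA.
rewrite !mulE => le_obj.
apply: kl_le0_eq => //; first exact: simplex_softmax.
  exact: softmax_gt0.
have := prox_kl sp; have := prox_kl simplex_softmax.
rewrite kl_refl; last exact: softmax_gt0.
lra.
Qed.

End softmax.

End MirrorStep.

(** * Differential Q-functions *)

Section PolicyEvaluation.
Context {R : realType} {S A : finType}.

(** The Markov operator on functions, over any finite type so that it serves both the chain on
    states and the chain on state-action pairs. *)
Definition kernel_act (T : finType) (M : T -> T -> R) (F : T -> R) (s : T) : R :=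
  \sum_u M s u * F u.

Lemma kernel_pow_act (M : S -> S -> R) t F s :
  \sum_u kernel_pow M t s u * F u = iter t (kernel_act M) F s.
Proof.
elim: t s => [|t IHt] s /=.
  rewrite (bigD1 s)//= eqxx mul1r big1 ?addr0// => u us.
  by rewrite eq_sym (negbTE us) mul0r.
under eq_bigr do rewrite mulr_suml.
rewrite exchange_big/=; apply: eq_bigr => v _.
by rewrite -IHt mulr_sumr; apply: eq_bigr => u _; rewrite mulrA.
Qed.

Lemma stationary_iter (M : S -> S -> R) nu t F : stationary M nu ->
  \sum_s nu s * iter t (kernel_act M) F s = \sum_s nu s * F s.
Proof.
move=> [_ nuM]; elim: t => //= t IHt; rewrite -IHt.
under eq_bigr do rewrite mulr_sumr.
rewrite exchange_big/=; apply: eq_bigr => u _.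
by rewrite -nuM mulr_suml; apply: eq_bigr => s _; rewrite mulrA.
Qed.

Lemma simplex_sum_norm_le (T : finType) (p F : T -> R) (B : R) : simplex p ->
  (forall u, `|F u| <= B) -> \sum_u p u * `|F u| <= B.
Proof.
move=> [p0 p1] FB; rewrite -[leRHS]mul1r -p1 mulr_suml.
by apply: ler_sum => u _; exact: ler_wpM2l.
Qed.

Lemma simplex_norm_sum (T : finType) (p F : T -> R) : simplex p ->
  `|\sum_u p u * F u| <= \sum_u p u * `|F u|.
Proof.
move=> [p0 _]; apply: le_trans (ler_norm_sum _ _ _) _.
by apply: ler_sum => u _; rewrite normrM ger0_norm.
Qed.

Lemma iter_kernel_act_le (M : S -> S -> R) (F : S -> R) (B : R) n s :
  (forall s, simplex (M s)) -> (forall u, `|F u| <= B) ->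
  `|iter n (kernel_act M) F s| <= B.
Proof.
move=> sM FB; elim: n s => //= n IHn s.
by apply: le_trans (simplex_norm_sum _ (sM s)) _; exact: simplex_sum_norm_le.
Qed.

(** The mixing condition is applied to the Dirac mass at [s]. Subtracting the zero mean of [F] under
    [nu] exposes the l1 distance, at most 1/2, as the factor of [B]. *)
Lemma mixing_contraction (M : S -> S -> R) nu t (F : S -> R) (B : R) s :
  mixing_times M nu t -> \sum_u nu u * F u = 0 -> (forall u, `|F u| <= B) ->
  `|iter t (kernel_act M) F s| <= B / 2.
Proof.
move=> [_ /(_ (fun u => (u == s)%:R))] mix nuF FB.
have pick (G : S -> R) : \sum_u (u == s)%:R * G u = G s.
  rewrite (bigD1 s)//= eqxx mul1r big1 ?addr0// => u us.
  by rewrite (negbTE us) mul0r.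
have simd : simplex (fun u => (u == s)%:R : R).
  by split=> //; under eq_bigr do rewrite -[_%:R]mulr1; rewrite pick.
rewrite -kernel_pow_act -[X in `|X|]subr0 -[X in _ - X]nuF -sumrB.
apply: le_trans (ler_norm_sum _ _ _) _.
apply: (@le_trans _ _ (\sum_u `|kernel_pow M t s u - nu u| * B)).
  by apply: ler_sum => u _; rewrite -mulrBl normrM ler_wpM2l.
rewrite -mulr_suml mulrC; apply: ler_wpM2l.
  by apply: le_trans (FB s).
move: (mix simd); rewrite /l1; under eq_bigr do rewrite pick.
by [].
Qed.

(* Past the first t terms the bound on F has halved: 2 t B = t B + 2 t (B / 2). *)
Lemma mixing_sum_le (M : S -> S -> R) nu t s N (F : S -> R) (B : R) :
  (forall s, simplex (M s)) -> stationary M nu -> mixing_times M nu t ->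
  \sum_u nu u * F u = 0 -> (forall u, `|F u| <= B) ->
  \sum_(0 <= n < N) `|iter n (kernel_act M) F s| <= 2 * t%:R * B.
Proof.
(* [F] and [B] are generalized: the tail beyond [t] is the same kind of sum for the iterated
   function with bound [B / 2]. *)
move=> sM nuM mix; elim/ltn_ind: N F B => N IHN F B nuF FB.
have B0 : 0 <= B by apply: le_trans (FB s).
have short m : \sum_(0 <= n < m) `|iter n (kernel_act M) F s| <= m%:R * B.
  rewrite mulr_natl -[X in _ *+ X]subn0 -sumr_const_nat.
  by apply: ler_sum => n _; exact: iter_kernel_act_le.
have [Nt|tN] := leqP N t.
  apply: le_trans (short N) _; apply: ler_wpM2r => //.
  by rewrite mulr_natl mulr2n ler_wpDl// ler_nat.
rewrite (big_cat_nat (n := t)) ?(ltnW tN)//= -{2}[t]add0n big_addn.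
have {IHN} := IHN (N - t)%N _ (iter t (kernel_act M) F) (B / 2).
rewrite stationary_iter// => /(_ _ nuF) IHN.
(* Mixing times are at least 1, so the tail is strictly shorter. *)
have Nt : (N - t < N)%N.
  by rewrite ltn_subrL (leq_trans _ tN) ?andbT//; case: mix.
have mixF u := mixing_contraction u mix nuF FB.
have := lerD (short t) (IHN Nt mixF).
under [X in _ + X <= _ -> _]eq_bigr do rewrite -iterD.
by move=> /le_trans; apply; lra.
Qed.

Variables (P : S -> A -> S -> R) (c : S -> A -> R) (h : S -> (A -> R) -> R).
Variable nu : (S -> A -> R) -> S -> R.

Hypothesis kerP : is_kernel P.

Lemma simplex_policy_kernel pi s : policy pi -> simplex (policy_kernel P pi s).
Proof.
move=> polpi; split=> [u|].
  by apply: sumr_ge0 => a _; rewrite mulr_ge0 ?(polpi s).1 ?(kerP s a).1.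
rewrite exchange_big/= -[RHS](polpi s).2; apply: eq_bigr => a _.
by rewrite -mulr_sumr (kerP s a).2 mulr1.
Qed.

Definition state_action_kernel (pi : S -> A -> R) (x y : S * A) : R :=
  P x.1 x.2 y.1 * pi y.1 y.2.

Lemma state_action_lawE pi s a t F :
  \sum_y state_action_law P pi s a t y * F y =
  iter t (kernel_act (state_action_kernel pi)) F (s, a).
Proof.
elim: t F => [|t IHt] F /=.
  rewrite (bigD1 (s, a))//= eqxx mul1r big1 ?addr0// => u /negbTE us.
  by rewrite us mul0r.
rewrite -iterS iterSr -IHt; under eq_bigr do rewrite mulr_suml.
rewrite exchange_big/=; apply: eq_bigr => x _.
by rewrite /kernel_act mulr_sumr; apply: eq_bigr => y _; rewrite !mulrA.
Qed.

Definition policy_mean (pi : S -> A -> R) (F : S * A -> R) (s : S) : R :=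
  \sum_a pi s a * F (s, a).

Lemma kernel_act_state_action pi F s a :
  kernel_act (state_action_kernel pi) F (s, a) =
  \sum_u P s a u * policy_mean pi F u.
Proof.
under [RHS]eq_bigr do rewrite /policy_mean mulr_sumr.
rewrite pair_bigA; apply: eq_bigr => -[u b] _.
by rewrite /state_action_kernel/= mulrA.
Qed.

(** Averaging over actions intertwines the two chains. Mixing is assumed for the chain on states
    only, and this carries it over to state-action pairs. *)
Lemma policy_mean_iter pi F t s :
  policy_mean pi (iter t (kernel_act (state_action_kernel pi)) F) s =
  iter t (kernel_act (policy_kernel P pi)) (policy_mean pi F) s.
Proof.
elim: t s => //= t IHt s; rewrite {1}/policy_mean.
under eq_bigr do rewrite kernel_act_state_action mulr_sumr.
rewrite exchange_big/= /kernel_act; apply: eq_bigr => u _.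
rewrite -IHt /policy_kernel mulr_suml.
by apply: eq_bigr => b _; rewrite mulrA.
Qed.

Section FixedPolicy.
Variable pi : S -> A -> R.
Hypothesis polpi : policy pi.
Hypothesis statpi : stationary (policy_kernel P pi) (nu pi).
Hypothesis mixpi : exists t, mixing_times (policy_kernel P pi) (nu pi) t.

Let f (y : S * A) := c y.1 y.2 + h y.1 (pi y.1) - avg_cost c h nu pi.

Let u x n := iter n (kernel_act (state_action_kernel pi)) f x.

Let mean_f s : policy_mean pi f s =
  policy_cost c pi s + h s (pi s) - avg_cost c h nu pi.
Proof.
rewrite /policy_mean /f/= /policy_cost.
under eq_bigr do rewrite mulrBr mulrDr.
rewrite sumrB big_split/= -!mulr_suml (polpi s).2 !mul1r.
by do 2 congr (_ + _); apply: eq_bigr => a _; rewrite mulrC.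
Qed.

Let diff_QE s a : diff_Q P c h nu pi s a = limn (series (u (s, a))).
Proof.
by rewrite /diff_Q /u; under eq_fun do rewrite state_action_lawE.
Qed.

Let nu_mean_f : \sum_s nu pi s * policy_mean pi f s = 0.
Proof.
under eq_bigr do rewrite mean_f mulrBr.
by rewrite sumrB -mulr_suml statpi.1.2 mul1r subrr.
Qed.

Let cvg_u x : cvgn (series (u x)).
Proof.
case: x => s a; apply: normed_cvg.
have [t mix] := mixpi.
pose B : R := \sum_s `|policy_mean pi f s|.
have FB s' : `|policy_mean pi f s'| <= B.
  by rewrite /B (bigD1 s')//= lerDl sumr_ge0.
apply: nondecreasing_is_cvgn.
  by apply: nondecreasing_series => n _ _ /=.
(* The term at time 0 is bounded separately: only after one transition is the pair chain an average,
   under [P s a], of the state chain, to which [mixing_sum_le] applies. *)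
exists (`|f (s, a)| + 2 * t%:R * B) => _ [N _ <-].
change (\sum_(0 <= n < N) `|u (s, a) n| <= `|f (s, a)| + 2 * t%:R * B).
case: N => [|N].
  rewrite big_geq// addr_ge0// !mulr_ge0//.
  by rewrite /B sumr_ge0.
rewrite big_nat_recl//= lerD2l.
apply: (@le_trans _ _ (\sum_(0 <= n < N) \sum_v P s a v *
    `|iter n (kernel_act (policy_kernel P pi)) (policy_mean pi f) v|)).
  apply: ler_sum => n _; rewrite kernel_act_state_action.
  apply: le_trans (simplex_norm_sum _ (kerP s a)) _.
  by apply: ler_sum => v _; rewrite policy_mean_iter.
rewrite exchange_big/=.
under eq_bigr do rewrite -mulr_sumr.
rewrite -[leRHS]mul1r -[X in X * _](kerP s a).2 mulr_suml; apply: ler_sum => v _.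
apply: ler_wpM2l; first exact: (kerP s a).1.
apply: mixing_sum_le mix _ _ => // s'; exact: simplex_policy_kernel.
Qed.

(** Dropping the first term leaves an average of the same partial sums one step later. Convergence
    [cvg_u] allows the limit to pass through the finite sums. *)
Lemma bellman s a : diff_Q P c h nu pi s a =
  c s a + h s (pi s) - avg_cost c h nu pi +
  \sum_v P s a v * \sum_b pi v b * diff_Q P c h nu pi v b.
Proof.
rewrite diff_QE; under [in RHS]eq_bigr do under eq_bigr do rewrite diff_QE.
apply: cvg_lim => //; rewrite -(cvg_shiftS (series (u (s, a)))).
have -> : [sequence series (u (s, a)) n.+1]_n = (fun n => f (s, a) +
   \sum_v P s a v * \sum_b pi v b * series (u (v, b)) n).
  apply/funext => n; rewrite seriesEnat/= big_nat_recl//=; congr (_ + _).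
  under [RHS]eq_bigr do under eq_bigr do rewrite mulr_sumr.
  under [RHS]eq_bigr do rewrite exchange_big mulr_sumr/=.
  rewrite [RHS]exchange_big/=; apply: eq_bigr => k _.
  by rewrite kernel_act_state_action.
apply: cvgD; first exact: cvg_cst.
apply: cvg_big => [|v _]; first exact: add_continuous.
apply: cvgMr; apply: cvg_big => [|b _]; first exact: add_continuous.
apply: cvgMr.
exact: cvg_u.
Qed.

(** The Bellman equation for [pi] is averaged over [pi'] and then over the stationary law of [pi'].
    Stationarity cancels the value terms, and the costs average to the difference of the two
    long-run costs. *)
Lemma performance_difference pi' : policy pi' ->
  stationary (policy_kernel P pi') (nu pi') ->
  (forall s, h s (pi' s) = h s (pi s)) ->
  avg_cost c h nu pi - avg_cost c h nu pi' =
  \sum_s nu pi' s * \sum_a diff_Q P c h nu pi s a * (pi s a - pi' s a).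
Proof.
move=> polpi' stat' hE; have [[_ nu1] _] := stat'.
pose V s := \sum_b pi s b * diff_Q P c h nu pi s b.
have Qmean s : \sum_a diff_Q P c h nu pi s a * pi' s a =
    policy_cost c pi' s + h s (pi' s) - avg_cost c h nu pi +
    \sum_v policy_kernel P pi' s v * V v.
  under eq_bigr do rewrite bellman mulrDl.
  rewrite big_split/=; congr (_ + _).
    under eq_bigr do rewrite mulrBl mulrDl.
    by rewrite sumrB big_split/= -!mulr_sumr (polpi' s).2 !mulr1 hE.
  under eq_bigr do rewrite mulr_suml.
  rewrite exchange_big/=; apply: eq_bigr => v _.
  rewrite /policy_kernel mulr_suml; apply: eq_bigr => a _.
  by rewrite mulrC mulrA.
have -> : \sum_s nu pi' s * \sum_a diff_Q P c h nu pi s a * (pi s a - pi' s a) =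
    \sum_s nu pi' s * V s - \sum_s nu pi' s * \sum_a diff_Q P c h nu pi s a * pi' s a.
  rewrite -sumrB; apply: eq_bigr => s _; rewrite -mulrBr; congr (_ * _).
  under eq_bigr do rewrite mulrBr.
  by rewrite sumrB; congr (_ - _); apply: eq_bigr => a _; rewrite mulrC.
under [X in _ = _ - X]eq_bigr do rewrite Qmean mulrDr mulrBr.
rewrite big_split/= sumrB -mulr_suml nu1 mul1r.
rewrite (stationary_iter 1 V stat').
rewrite /avg_cost; lra.
Qed.

End FixedPolicy.

End PolicyEvaluation.

(** * Span seminorm *)

Section Span.
Context {R : realType}.

(** The regret bound allows any centre; the midpoint of the range halves the radius, which is where
    the factor 1/4 on the squared span arises. *)
Lemma span_midpoint (T : finType) (x : T -> R) :
  exists m, forall t, `|x t - m| <= span_seminorm x / 2.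
Proof.
exists ((sup (range x) + inf (range x)) / 2) => t; rewrite /span_seminorm.
have xbnd u : `|x u| <= \sum_v `|x v| by rewrite (bigD1 u)//= lerDl sumr_ge0.
have xsup : x t <= sup (range x).
  apply: ub_le_sup; last by exists t.
  by exists (\sum_v `|x v|) => _ [u _ <-]; apply: le_trans (xbnd u); exact: ler_norm.
have infx : inf (range x) <= x t.
  apply: ge_inf; last by exists t.
  by exists (- \sum_v `|x v|) => _ [u _ <-]; have := xbnd u; rewrite ler_norml => /andP[].
by rewrite ler_norml; apply/andP; split; lra.
Qed.

(** At each state both action averages lie within half the span of the midpoint, so they differ by
    at most the span. This bounds the effect of the critic bias. *)
Lemma span_dual (S A : finType) (X : S * A -> R) (q : S -> R)
    (p p' : S -> A -> R) : simplex q -> policy p -> policy p' ->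
  \sum_s q s * \sum_a X (s, a) * (p s a - p' s a) <= span_seminorm X.
Proof.
move=> [q0 q1] polp polp'; have [m Xm] := span_midpoint X.
rewrite -[leRHS]mul1r -[X in X * _]q1 mulr_suml; apply: ler_sum => s _.
apply: ler_wpM2l => //.
have mean_le pol : policy pol ->
    `|\sum_a pol s a * (X (s, a) - m)| <= span_seminorm X / 2.
  move=> /(_ s) spol; apply: le_trans (simplex_norm_sum _ spol) _.
  exact: simplex_sum_norm_le.
have -> : \sum_a X (s, a) * (p s a - p' s a) =
    \sum_a p s a * (X (s, a) - m) - \sum_a p' s a * (X (s, a) - m).
  under [in RHS]eq_bigr do rewrite mulrBr.
  under [X in _ = _ - X]eq_bigr do rewrite mulrBr.
  rewrite !sumrB -!mulr_suml (polp s).2 (polp' s).2 opprB addrA subrK -sumrB.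
  by apply: eq_bigr => a _; rewrite mulrBr ![X (s, a) * _]mulrC.
have := mean_le _ polp; have := mean_le _ polp'.
by rewrite !ler_norml => /andP[? ?] /andP[? ?]; lra.
Qed.

End Span.

(** * Comparison of integrals and finite sums *)

Section Integral.
Context {R : realType} {d : measure_display} {T : measurableType d}.
Variable mu : {measure set T -> \bar R}.

(* The integral of a nonnegative function is a lower integral, so no
   measurability of [f] is needed. *)
Lemma ge0_ae_le_integral_nonmeasurable (f g : T -> R) :
  (forall x, 0 <= f x) -> mu.-integrable setT (EFin \o g) ->
  {ae mu, forall x, f x <= g x} ->
  (\int[mu]_x (f x)%:E <= \int[mu]_x (g x)%:E)%E.
Proof.
move=> f0 ig [N [mN N0 subN]].
have mg := measurable_int _ ig.
(* Setting [g'] to [+oo] on the null set [N] makes [f <= g'] hold everywhere without changing the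
   integral of [g]. Every simple function below [f] is then below [g']. *)
pose g' x : \bar R := if x \in N then +oo%E else (Num.max (g x) 0)%:E.
have mg' : measurable_fun setT g'.
  apply: measurable_fun_ifT => //.
    apply: (measurable_fun_bool true).
    rewrite setTI (_ : _ @^-1` _ = N)//; apply/seteqP.
    by split=> x /=; [move/set_mem|move=> Nx; rewrite mem_set].
  by apply/measurable_EFinP/measurable_maxr => //; exact/measurable_EFinP.
have g'0 x : (0 <= g' x)%E.
  by rewrite /g'; case: ifP => // _; rewrite lee_fin le_max lexx orbT.
have -> : (\int[mu]_x (g x)%:E = \int[mu]_x g' x)%E.
  apply: ae_eq_integral => //; exists N; split => // x /= /not_implyP[_ gg'].
  apply: contrapT => xN; apply: gg'; rewrite /g' memNset//.
  have fgx : f x <= g x by apply: contrapT => nfg; apply: xN; exact: subN.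
  by rewrite max_l// (le_trans (f0 x)).
rewrite !ge0_integralTE//; apply: ereal_sup_le => _ [h hf <-].
exists h => // x; apply: le_trans (hf x) _; rewrite /g'; case: ifPn => [_|].
  exact: leey.
rewrite notin_setE => xN; rewrite lee_fin le_max; apply/orP; left.
by apply: contrapT => nfg; apply: xN; exact: subN.
Qed.

Lemma integrable_sum_EFin (I : Type) (s : seq I) (f : I -> T -> R) :
  (forall i, mu.-integrable setT (EFin \o f i)) ->
  mu.-integrable setT (fun w => (\sum_(i <- s) f i w)%:E).
Proof.
move=> intf.
rewrite (_ : (fun w => _) = fun w => \sum_(i <- s) (f i w)%:E)%E.
  by apply: integrable_sum => // i _; exact: intf.
by apply/funext => w; rewrite sumEFin.
Qed.

Lemma integral_sum_EFin (I : Type) (s : seq I) (f : I -> T -> R) :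
  (forall i, mu.-integrable setT (EFin \o f i)) ->
  (\int[mu]_w (\sum_(i <- s) f i w)%:E = \sum_(i <- s) \int[mu]_w (f i w)%:E)%E.
Proof.
move=> intf; rewrite -integral_sum//.
by apply: eq_integral => w _; rewrite sumEFin.
Qed.

End Integral.

(** * Conditional expectations *)

Section ConditionalExpectation.
Context {R : realType} {d : measure_display} {T : measurableType d}.
Variables (Pr : probability T R) (F : set (set T)).
Hypothesis sigmaF : <<s F >> = F.
Hypothesis FT : F `<=` measurable.

Lemma measurable_fun_sub_sigma d' (U : measurableType d') (f : T -> U) :
  measurable_fun (setT : set (g_sigma_algebraType F)) f ->
  measurable_fun setT f.
Proof.
have subF : <<s F>> `<=` F by rewrite sigmaF.
by move=> mf _ Y mY; apply/FT/subF; exact: (mf measurableT Y mY).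
Qed.

Lemma integrable_mul_bounded (Z X : T -> R) (B : R) :
  measurable_fun setT Z -> (forall w, `|Z w| <= B) ->
  Pr.-integrable setT (EFin \o X) ->
  Pr.-integrable setT (fun w => (Z w * X w)%:E).
Proof.
move=> mZ ZB iX; apply: (@le_integrable _ _ _ _ _ measurableT _
    (fun w => B%:E * (X w)%:E)%E).
- apply/measurable_EFinP/measurable_funM => //.
  by apply/measurable_EFinP; exact: measurable_int iX.
- move=> w _; rewrite /= lee_fin !normrM ler_wpM2r//.
  by apply: le_trans (ZB w) _; exact: ler_norm.
- exact: integrableZl.
Qed.

Variables X Y : T -> R.
Hypothesis condX : is_cond_exp Pr F X Y.

Let iX : Pr.-integrable setT (EFin \o X). Proof. by case: condX. Qed.

Let iY : Pr.-integrable setT (EFin \o Y). Proof. by case: condX. Qed.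

Import HBNNSimple.

(** The level sets of [h] belong to [F], and on each the defining property of conditional
    expectation applies. *)
Let integral_nnsfun_mul (h : {nnsfun (g_sigma_algebraType F) >-> R}) :
  (\int[Pr]_w (h w * X w)%:E = \int[Pr]_w (h w * Y w)%:E)%E.
Proof.
have subF : <<s F>> `<=` F by rewrite sigmaF.
have FB y : F (h @^-1` [set y]).
  apply: subF; rewrite -[_ @^-1` _]setTI.
  by apply: (@measurable_funP _ _ (g_sigma_algebraType F) R setT h) => //.
have mB y : measurable (h @^-1` [set y] : set T) by exact: FT.
have integ (V : T -> R) : Pr.-integrable setT (EFin \o V) ->
    (\int[Pr]_w (h w * V w)%:E = \sum_(y <- finmap.enum_fset (fset_set (range h)))
       y%:E * \int[Pr]_(w in h @^-1` [set y]) (V w)%:E)%E.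
  move=> iV.
  have iBV y : Pr.-integrable setT (EFin \o V \_ (h @^-1` [set y])).
    rewrite -restrict_EFin.
    apply/(integrable_restrict Pr (mB y) measurableT _).1.
    by rewrite setTI; apply: integrableS iV.
  transitivity (\int[Pr]_w \sum_(y <- finmap.enum_fset (fset_set (range h)))
      y%:E * (EFin \o V \_ (h @^-1` [set y])) w)%E.
    apply: eq_integral => w _.
    rewrite fimfunE fsbig_finite//= mulr_suml -sumEFin.
    apply: eq_bigr => y _; rewrite -EFinM -mulrA patchE indicE.
    by case: ifP => _; rewrite ?mul1r// mul0r.
  rewrite integral_sum//; last by move=> y; exact: integrableZl.
  apply: eq_bigr => y _; rewrite integralZl//; congr (_ * _)%E.
  by rewrite [RHS]integral_mkcond restrict_EFin.
by rewrite !integ//; apply: eq_bigr => y _; case: condX => _ _ _ ->.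
Qed.

(** [Z] is approximated from below by simple functions measurable for [F]; dominated convergence
    applies on both sides, with [|Z V|] as the dominating function. *)
Let integral_ge0_mul (Z : T -> R) :
  measurable_fun (setT : set (g_sigma_algebraType F)) Z ->
  (forall w, 0 <= Z w) ->
  Pr.-integrable setT (fun w => (Z w * X w)%:E) ->
  Pr.-integrable setT (fun w => (Z w * Y w)%:E) ->
  (\int[Pr]_w (Z w * X w)%:E = \int[Pr]_w (Z w * Y w)%:E)%E.
Proof.
move=> mZ Z0 iZX iZY.
have mEZ : measurable_fun (setT : set (g_sigma_algebraType F)) (EFin \o Z).
  exact/measurable_EFinP.
pose z n := nnsfun_approx measurableT mEZ n.
have mz n : measurable_fun setT (z n : T -> R).
  by apply: measurable_fun_sub_sigma; exact: measurable_funP.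
have zZ n w : z n w <= Z w.
  by rewrite /z nnsfun_approxE -lee_fin; apply: le_approx => // v _; rewrite lee_fin.
have z_cvg w : z n w @[n --> \oo] --> Z w.
  have /fine_cvg := @cvg_nnsfun_approx _ _ _ _ measurableT _ mEZ (fun v _ => Z0 v) w I.
  by apply.
have dct (V : T -> R) : Pr.-integrable setT (EFin \o V) ->
    Pr.-integrable setT (fun w => (Z w * V w)%:E) ->
    (\int[Pr]_w (z n w * V w)%:E)%E @[n --> \oo] --> (\int[Pr]_w (Z w * V w)%:E)%E.
  move=> iV iZV.
  have [|||||_ _ //] := @dominated_convergence _ _ _ Pr setT measurableT
      (fun n w => (z n w * V w)%:E) (fun w => (Z w * V w)%:E)
      (fun w => `|(Z w * V w)%:E|)%E.
  - move=> n; apply/measurable_EFinP/measurable_funM => //.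
    by apply/measurable_EFinP; exact: measurable_int iV.
  - exact: measurable_int iZV.
  - apply: aeW => w _; apply: cvg_EFin; first by near=> n.
    by apply: cvgMl; exact: z_cvg.
  - exact: integrable_abse.
  - apply: aeW => w n _ /=; rewrite lee_fin !normrM ler_wpM2r//.
    by rewrite !ger0_norm.
apply: (@cvg_unique _ _ _ _ _ _ (dct _ iX iZX)) => //.
rewrite (_ : (fun n => _) = fun n => (\int[Pr]_w (z n w * Y w)%:E)%E).
  exact: dct.
by apply/funext => n; exact: integral_nnsfun_mul.
Unshelve. all: by end_near. Qed.

(** A factor known to [F] can be taken out. [Z] need not be bounded: its positive and negative parts
    are smaller in modulus, so their products with [X] and [Y] stay integrable. *)
Lemma cond_exp_mul (Z : T -> R) :
  measurable_fun (setT : set (g_sigma_algebraType F)) Z ->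
  Pr.-integrable setT (fun w => (Z w * X w)%:E) ->
  Pr.-integrable setT (fun w => (Z w * Y w)%:E) ->
  (\int[Pr]_w (Z w * X w)%:E = \int[Pr]_w (Z w * Y w)%:E)%E.
Proof.
move=> mZ iZX iZY.
pose Zp w := Num.max (Z w) 0; pose Zn w := Num.max (- Z w) 0.
have ZE w : Z w = Zp w - Zn w.
  rewrite /Zp /Zn; have [Z0|/ltW Z0] := leP 0 (Z w).
    by rewrite max_r ?subr0// oppr_le0.
  by rewrite max_l ?sub0r ?opprK// oppr_ge0.
have mZp : measurable_fun (setT : set (g_sigma_algebraType F)) Zp.
  exact: measurable_maxr.
have mZn : measurable_fun (setT : set (g_sigma_algebraType F)) Zn.
  by apply: measurable_maxr => //; exact: measurable_funN.
have part (V : T -> R) (W : T -> R) : Pr.-integrable setT (EFin \o V) ->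
    measurable_fun (setT : set (g_sigma_algebraType F)) W ->
    (forall w, `|W w| <= `|Z w|) ->
    Pr.-integrable setT (fun w => (Z w * V w)%:E) ->
    Pr.-integrable setT (fun w => (W w * V w)%:E).
  move=> iV mW WZ; apply: le_integrable => //.
    apply/measurable_EFinP/measurable_funM; first exact: measurable_fun_sub_sigma.
    by apply/measurable_EFinP; exact: measurable_int iV.
  by move=> w _; rewrite /= lee_fin !normrM ler_wpM2r.
have ZpZ w : `|Zp w| <= `|Z w|.
  by rewrite ger0_norm ?le_max ?lexx ?orbT// ge_max ler_norm normr_ge0.
have ZnZ w : `|Zn w| <= `|Z w|.
  by rewrite ger0_norm ?le_max ?lexx ?orbT// ge_max -normrN ler_norm normr_ge0.
have split (V : T -> R) : Pr.-integrable setT (EFin \o V) ->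
    Pr.-integrable setT (fun w => (Z w * V w)%:E) ->
    (\int[Pr]_w (Z w * V w)%:E =
     \int[Pr]_w (Zp w * V w)%:E - \int[Pr]_w (Zn w * V w)%:E)%E.
  move=> iV iZV; rewrite -integralB_EFin//; [|exact: part|exact: part].
  by apply: eq_integral => w _; rewrite -EFinB -mulrBl -ZE.
rewrite !split//; congr (_ - _)%E; apply: integral_ge0_mul => //;
  by [move=> w; rewrite le_max lexx orbT | exact: part].
Qed.

End ConditionalExpectation.

(** * Filtration generated by the samples *)

Section History.
Context {d d' : measure_display} {Omega : measurableType d} {Z : measurableType d'}.
Variable zeta : nat -> Omega -> Z.

Lemma history_sigma_algebra k : <<s history zeta k>> = history zeta k.
Proof. exact/smallest_id/smallest_sigma_algebra. Qed.

Lemma history_sub (G : set (set Omega)) k : sigma_algebra setT G ->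
  (forall i B, (i < k)%N -> measurable B -> G (zeta i @^-1` B)) ->
  history zeta k `<=` G.
Proof.
move=> sG zG; apply: smallest_sub => // B.
rewrite -bigcup_seq/= => -[i _ [C mC <-]].
by rewrite setTI; exact: zG.
Qed.

Lemma history_mono k k' : (k <= k')%N -> history zeta k `<=` history zeta k'.
Proof.
move=> kk'; apply: history_sub; first exact: smallest_sigma_algebra.
move=> i B ik mB; apply: sub_sigma_algebra; rewrite -bigcup_seq/=.
exists (Ordinal (leq_trans ik kk')); first by rewrite /= mem_index_enum.
by exists B => //; rewrite setTI.
Qed.

Lemma history_measurable k : (forall i, measurable_fun setT (zeta i)) ->
  history zeta k `<=` measurable.
Proof.
move=> mz; apply: history_sub; first exact: sigma_algebra_measurable.
by move=> i B _ mB; rewrite -[_ @^-1` _]setTI; exact: mz.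
Qed.

Lemma measurable_fun_history_mono d'' (U : measurableType d'') (f : Omega -> U)
    k k' : (k <= k')%N ->
  measurable_fun (setT : set (g_sigma_algebraType (history zeta k))) f ->
  measurable_fun (setT : set (g_sigma_algebraType (history zeta k'))) f.
Proof.
move=> kk' mf _ B mB; have := mf measurableT B mB.
have sub : <<s history zeta k>> `<=` <<s history zeta k'>>.
  by rewrite !history_sigma_algebra; exact: history_mono.
exact: sub.
Qed.

End History.

(** * Integrals of conditional expectations *)

Section ConditionalIntegrals.
Context {R : realType} {d : measure_display} {T : measurableType d}.
Variables (Pr : probability T R).

Lemma integral_le_ae (f g : T -> R) :
  Pr.-integrable setT (EFin \o f) -> Pr.-integrable setT (EFin \o g) ->
  {ae Pr, forall w, f w <= g w} ->
  (\int[Pr]_w (f w)%:E <= \int[Pr]_w (g w)%:E)%E.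
Proof.
move=> intf intg fg.
have intd : Pr.-integrable setT (fun w => (g w - f w)%:E).
  exact: (integrableB measurableT intg intf).
rewrite -sube_ge0 ?integrable_fin_num//.
rewrite -integralB_EFin//.
(* Almost everywhere [g - f] equals its absolute value, whose integral is nonnegative. *)
rewrite (_ : integral _ _ _ = (\int[Pr]_w `|(g w - f w)%:E|)%E).
  by apply: integral_ge0 => w _; exact: abse_ge0.
apply: ae_eq_integral => //; first exact: measurable_int intd.
  exact: (measurable_int _ (integrable_abse intd)).
apply: filterS fg => w fgw _; rewrite gee0_abs//.
by rewrite lee_fin subr_ge0.
Qed.

Lemma cond_exp_independent_index (F : set (set T)) (K : nat) (r : T -> 'I_K) j :
  F `<=` measurable -> uniform_independent_index Pr F r ->
  is_cond_exp Pr F (\1_(r @^-1` [set j])) (cst K%:R^-1).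
Proof.
move=> FT /(_ j)[mr rK rF]; split.
- exact: integrable_indic.
- exact: finite_measure_integrable_cst.
- exact: measurable_cst.
- move=> B FB; have mB := FT _ FB.
  rewrite (integral_cst Pr mB (K%:R^-1)%:E) integral_indic// -rK.
  exact/esym/rF.
Qed.

Lemma cond_exp_sum (I : finType) (F : set (set T)) (Z X Y : I -> T -> R) (B : R) :
  <<s F >> = F -> F `<=` measurable ->
  (forall i, measurable_fun (setT : set (g_sigma_algebraType F)) (Z i)) ->
  (forall i w, `|Z i w| <= B) ->
  (forall i, is_cond_exp Pr F (X i) (Y i)) ->
  [/\ Pr.-integrable setT (fun w => (\sum_i Z i w * X i w)%:E),
      Pr.-integrable setT (fun w => (\sum_i Z i w * Y i w)%:E) &
      (\int[Pr]_w (\sum_i Z i w * X i w)%:E =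
       \int[Pr]_w (\sum_i Z i w * Y i w)%:E)%E].
Proof.
move=> sF FT mZ ZB cXY.
have mZT i : measurable_fun setT (Z i).
  exact: (measurable_fun_sub_sigma sF FT (mZ i)).
have iX i : Pr.-integrable setT (fun w => (Z i w * X i w)%:E).
  by apply: (integrable_mul_bounded (mZT i) (ZB i)); case: (cXY i).
have iY i : Pr.-integrable setT (fun w => (Z i w * Y i w)%:E).
  by apply: (integrable_mul_bounded (mZT i) (ZB i)); case: (cXY i).
split; [exact: integrable_sum_EFin|exact: integrable_sum_EFin|].
rewrite !integral_sum_EFin//; apply: eq_bigr => i _.
by apply: (@cond_exp_mul _ _ _ _ F).
Qed.

End ConditionalIntegrals.

(** * Regret of the SPMD iterates *)

Section Regret.
Context {R : realType} {S A : finType}.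

Lemma uniform_simplex : (0 < #|A|)%N -> simplex ((fun=> #|A|%:R^-1) : A -> R).
Proof.
move=> A0; split=> [a|]; first by rewrite invr_ge0.
by rewrite sumr_const -[LHS]mulr_natl mulfV// pnatr_eq0 -lt0n.
Qed.

(** The divergences from [pstar] telescope. The first is at most [ln #|A|] because the start is
    uniform, and the last is nonnegative and dropped. *)
Lemma mirror_regret (p x : nat -> A -> R) (pstar : A -> R) (m r : nat -> R) K :
  (0 < #|A|)%N -> simplex pstar -> p 0%N = (fun=> #|A|%:R^-1) ->
  (forall k, p k.+1 = softmax (p k) (x k)) ->
  (forall k a, `|x k a - m k| <= r k) ->
  \sum_(0 <= k < K) \sum_a x k a * (p k a - pstar a) <=
    ln #|A|%:R + \sum_(0 <= k < K) r k ^+ 2.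
Proof.
move=> A0 sstar p0 pS xr.
have sp k : simplex (p k) /\ forall a, 0 < p k a.
  elim: k => [|k [spk pk0]].
    by rewrite p0; split=> [|a]; [exact: uniform_simplex|rewrite invr_gt0 ltr0n].
  by rewrite pS; split; [exact: simplex_softmax|exact: softmax_gt0].
(* The induction must keep the last divergence, which the next step consumes. *)
suff : \sum_(0 <= k < K) \sum_a x k a * (p k a - pstar a) <=
    kl pstar (p 0%N) - kl pstar (p K) + \sum_(0 <= k < K) r k ^+ 2.
  have := kl_uniform sstar; rewrite -p0.
  have := kl_ge0 sstar (sp K).1 (sp K).2; lra.
elim: K => [|K IHK]; first by rewrite !big_geq// subrr addr0.
rewrite !big_nat_recr//=.
have := mirror_step (sp K).1 (sp K).2 sstar (xr K); rewrite -pS; lra.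
Qed.

(** The right-hand side of [performance_difference] with an arbitrary [X] in place of the
    Q-function, so that estimator, conditional mean and true value can be exchanged. *)
Definition weighted_gap (q : S -> R) (X : S * A -> R) (p p' : S -> A -> R) : R :=
  \sum_s q s * \sum_a X (s, a) * (p s a - p' s a).

Lemma weighted_gapE q X p p' : weighted_gap q X p p' =
  \sum_(x : S * A) q x.1 * (p x.1 x.2 - p' x.1 x.2) * X x.
Proof.
rewrite /weighted_gap; under eq_bigr do rewrite mulr_sumr.
rewrite pair_bigA/=; apply: eq_bigr => -[s a] _ /=.
by rewrite -mulrA [X in _ * X]mulrC.
Qed.

(** The policies are swapped in the remainder so that it involves [Y - X], the sign in which the
    critic bias is bounded. *)
Lemma weighted_gapB q X Y p p' :
  weighted_gap q X p p' = weighted_gap q Y p p' +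
    weighted_gap q (fun x => Y x - X x) p' p.
Proof.
rewrite !weighted_gapE -big_split/=; apply: eq_bigr => x _; ring.
Qed.

(** With no mixing time the inner infimum would be [+oo], and so would the supremum. *)
Lemma tmix_mixing (P : S -> A -> S -> R) nu pi :
  (tmix P nu < +oo)%E -> policy pi ->
  exists t, mixing_times (policy_kernel P pi) (nu pi) t.
Proof.
move=> tmix_lt polpi; apply: contrapT => nomix.
suff : (+oo <= tmix P nu)%E by move=> /(lt_le_trans tmix_lt); rewrite ltxx.
apply: ereal_sup_ubound; exists pi => //.
rewrite (_ : [set _ | _ in _] = set0) ?ereal_inf0//.
by apply/seteqP; split=> // x [t mt _]; apply: nomix; exists t.
Qed.

Lemma lipschitz0_cst (h : S -> (A -> R) -> R) s p p' :
  lipschitz_regularizer h 0 -> simplex p -> simplex p' -> h s p = h s p'.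
Proof.
move=> /(_ s (fun=> p) (fun=> p')) lip sp sp'.
have := lip (fun=> sp) (fun=> sp').
by rewrite mul0r normr_le0 subr_eq0 => /eqP.
Qed.

Lemma simplex_le1 (p : A -> R) a : simplex p -> p a <= 1.
Proof. by move=> [p0 <-]; rewrite (bigD1 a)//= lerDl sumr_ge0. Qed.

Lemma simplex_card1 (p p' : A -> R) : #|A| = 1%N -> simplex p -> simplex p' -> p = p'.
Proof.
move=> /eqP/fintype1P[a allA] [_ p1] [_ p1']; apply/funext => b.
have val1 (q : A -> R) : \sum_c q c = q b.
  by rewrite (bigD1 b)//= big1 ?addr0// => c; rewrite (allA c) (allA b) eqxx.
by rewrite -val1 p1 -p1' val1.
Qed.

Section Run.
Context {Omega : Type}.
Variables (h : S -> (A -> R) -> R) (lam : R) (pi Q : nat -> Omega -> S -> A -> R).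
Hypothesis A_gt0 : (0 < #|A|)%N.
Hypothesis hcst : forall s p p', simplex p -> simplex p' -> h s p = h s p'.
Hypothesis run : spmd_run h (fun=> lam) pi Q.

Lemma run_simplex k w s : simplex (pi k w s).
Proof.
case: k => [|k]; last by have [] := run.2 k w s.
rewrite (_ : pi 0%N w s = fun=> #|A|%:R^-1); first exact: uniform_simplex.
by apply/funext => a; exact: run.1.
Qed.

(** Positivity and the closed form go together: the closed form at step [k] needs a positive [pi k],
    and the softmax keeps the next policy positive. *)
Lemma run_gt0_softmax k w s : (forall a, 0 < pi k w s a) /\
  pi k.+1 w s = softmax (pi k w s) (fun a => lam * Q k w s a).
Proof.
have step j : (forall a, 0 < pi j w s a) ->
    pi j.+1 w s = softmax (pi j w s) (fun a => lam * Q j w s a).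
  move=> pj0; have sj := run_simplex j w s.
  exact: (prox_softmax sj pj0 erefl (hcst s) (run.2 j w s)).
suff pk0 : forall a, 0 < pi k w s a by split=> //; exact: step.
elim: k => [|k IHk] a; first by rewrite run.1 invr_gt0 ltr0n.
by rewrite step//; apply: softmax_gt0 => //; exact: run_simplex.
Qed.

(** [mirror_regret] holds at each state with loss [lam * Q] and radius [lam] times half the span;
    the states are then averaged under [q]. Keeping the factor [lam] on the left covers
    [lam = 0]. *)
Lemma run_regret (q : S -> R) (pstar : S -> A -> R) K w :
  simplex q -> policy pstar -> 0 <= lam ->
  lam * \sum_(0 <= k < K) weighted_gap q (fun x => Q k w x.1 x.2) (pi k w) pstar
  <= ln #|A|%:R + lam ^+ 2 / 4 *
     \sum_(0 <= k < K) span_seminorm (fun x : S * A => Q k w x.1 x.2) ^+ 2.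
Proof.
move=> [q0 q1] polstar lam0.
have /choice[m Hm] k := span_midpoint (fun x : S * A => Q k w x.1 x.2).
set V := \sum_(0 <= k < K) span_seminorm _ ^+ 2.
have reg s : \sum_(0 <= k < K) \sum_a lam * Q k w s a * (pi k w s a - pstar s a)
    <= ln #|A|%:R + lam ^+ 2 / 4 * V.
  have -> : lam ^+ 2 / 4 * V = \sum_(0 <= k < K)
      (lam * (span_seminorm (fun x : S * A => Q k w x.1 x.2) / 2)) ^+ 2.
    by rewrite mulr_sumr; apply: eq_bigr => k _; field.
  apply: (@mirror_regret (fun k => pi k w s) (fun k a => lam * Q k w s a)
    (pstar s) (fun k => lam * m k)) => //.
  - by apply/funext => a; exact: run.1.
  - by move=> k; exact: (run_gt0_softmax k w s).2.
  - move=> k a; rewrite -mulrBr normrM ger0_norm// ler_wpM2l//.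
    exact: (Hm k (s, a)).
rewrite -[leRHS]mul1r -[X in _ <= X * _]q1 [leRHS]mulr_suml.
rewrite /weighted_gap exchange_big/= mulr_sumr; apply: ler_sum => s _.
rewrite -mulr_sumr mulrCA; apply: ler_wpM2l => //.
apply: le_trans (reg s); rewrite mulr_sumr; apply: ler_sum => k _.
by rewrite mulr_sumr; apply: ler_sum => a _; rewrite mulrA.
Qed.

End Run.

End Regret.

(** * Measurability of the iterates *)

Lemma measurable_softmax (R : realType) (A : finType) (d : measure_display)
    (T : measurableType d) (p x : T -> A -> R) a :
  (forall w b, 0 < p w b) ->
  (forall b, measurable_fun setT (fun w => p w b)) ->
  (forall b, measurable_fun setT (fun w => x w b)) ->
  measurable_fun setT (fun w => softmax (p w) (x w) a).
Proof.
move=> p0 mp mx.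
have mexp (f : T -> R) : measurable_fun setT f ->
    measurable_fun setT (fun w => expR (f w)).
  by move=> mf; apply: measurableT_comp => //; exact: measurable_expR.
have mw b : measurable_fun setT (fun w => p w b * expR (- x w b)).
  by apply: measurable_funM => //; apply: mexp; exact: measurable_funN.
(* The inverse of the positive normalizer is written as [expR (- ln _)], so that measurability of
   [expR] and [ln] suffices. *)
rewrite (_ : (fun w => _) = fun w => p w a * expR (- x w a) *
    expR (- ln (\sum_b p w b * expR (- x w b)))).
  apply: measurable_funM => //; apply: mexp; apply: measurable_funN.
  apply: (measurableT_comp (@measurable_ln R)); exact: measurable_sum.
apply/funext => w; congr (_ * _).
rewrite [RHS]expRN lnK// posrE (bigD1 a)//=; apply: ltr_pwDl.
  by rewrite mulr_gt0 ?expR_gt0.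
by apply: sumr_ge0 => b _; rewrite mulr_ge0 ?expR_ge0 ?ltW.
Qed.

(** The iterates are predictable: [pi k.+1] is a softmax of [pi k] and of the estimate at step [k],
    both known from the first [k.+1] samples. *)
Lemma measurable_run (R : realType) (S A : finType)
    (d : measure_display) (Omega : measurableType d)
    (d' : measure_display) (Z : measurableType d') (zeta : nat -> Omega -> Z)
    (h : S -> (A -> R) -> R) (lam : R) (pi Q : nat -> Omega -> S -> A -> R) :
  (0 < #|A|)%N ->
  (forall s p p', simplex p -> simplex p' -> h s p = h s p') ->
  spmd_run h (fun=> lam) pi Q ->
  (forall k s a, measurable_fun
     (setT : set (g_sigma_algebraType (history zeta k.+1)))
     (fun w => Q k w s a)) ->
  forall k s a, measurable_fun
    (setT : set (g_sigma_algebraType (history zeta k)))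
    (fun w => pi k w s a).
Proof.
move=> A0 hcst run mQ; elim=> [|k IHk] s a.
  rewrite (_ : (fun w => _) = cst #|A|%:R^-1) //.
  by apply/funext => w; exact: run.1.
rewrite (_ : (fun w => _) = fun w =>
    softmax (pi k w s) (fun a => lam * Q k w s a) a); last first.
  by apply/funext => w; rewrite (run_gt0_softmax A0 hcst run k w s).2.
apply: (@measurable_softmax _ _ _ (g_sigma_algebraType (history zeta k.+1))
  (fun w => pi k w s)) => [w b|b|b].
- exact: (run_gt0_softmax A0 hcst run k w s).1.
- exact: (measurable_fun_history_mono (leqnSn k)).
- by apply: measurable_funM => //; exact: mQ.
Qed.

Lemma simplex_card_gt0 (R : realType) (T : finType) (p : T -> R) :
  simplex p -> (0 < #|T|)%N.
Proof.
move=> [_ p1]; rewrite lt0n; apply/negP => /eqP/card0_eq T0.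
by move: p1; rewrite big_pred0// => /eqP; rewrite eq_sym oner_eq0.
Qed.

Lemma integral_cond_exp_le (R : realType) (d : measure_display)
    (T : measurableType d) (Pr : probability T R) (F : set (set T))
    (X Y : T -> R) (C : R) : <<s F >> = F ->
  is_cond_exp Pr F X Y -> {ae Pr, forall w, Y w <= C} ->
  (\int[Pr]_w (X w)%:E <= C%:E)%E.
Proof.
move=> sF [iX iY _ XY] YC.
have FT : F setT.
  have subF : <<s F>> `<=` F by rewrite sF.
  by apply: subF; exact: (@measurableT _ (g_sigma_algebraType F)).
rewrite -XY//; have /le_trans := integral_le_ae iY
  (finite_measure_integrable_cst Pr C measurableT) YC.
apply; rewrite (integral_cst Pr measurableT C%:E).
by rewrite [X in (_ * X)%E]probability_setT mule1.
Qed.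

(** * Expected regret and the random index *)

Theorem theorem1 (R : realType) (S A : finType)
  (P : S -> A -> S -> R) (c : S -> A -> R) (h : S -> (A -> R) -> R)
  (nu : (S -> A -> R) -> S -> R) (pistar : S -> A -> R)
  (d : measure_display) (Omega : measurableType d) (Pr : probability Omega R)
  (d' : measure_display) (Z : measurableType d') (zeta : nat -> Omega -> Z)
  (Qest : (S -> A -> R) -> Z -> S -> A -> R)
  (pi : nat -> Omega -> S -> A -> R)
  (varsigma sigma kappa : R) (K : nat) :
  is_kernel P ->
  (forall p, policy p -> stationary (policy_kernel P p) (nu p)) ->
  (tmix P nu < +oo)%E ->
  regularizer h 0 ->
  lipschitz_regularizer h 0 ->
  optimal_policy c h nu pistar ->
  (forall k, measurable_fun setT (zeta k)) ->
  (forall k s a,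
     measurable_fun (setT : set (g_sigma_algebraType (history zeta k.+1)))
       (fun w => Qest (pi k w) (zeta k w) s a)) ->
  0 <= varsigma -> 0 <= sigma -> 0 < kappa ->
  (1 <= K)%N ->
  spmd_run h
    (fun=> 2 * Num.sqrt (ln #|A|%:R) / (kappa * Num.sqrt K%:R))
    pi (fun k w => Qest (pi k w) (zeta k w)) ->
  critic_error Pr zeta
    (fun k w => Qest (pi k w) (zeta k w))
    (fun k w => diff_Q P c h nu (pi k w))
    varsigma sigma kappa ->
  ('E_Pr[(fun w => \sum_(0 <= k < K)
           (avg_cost c h nu (pi k w) - avg_cost c h nu pistar))%R]
     <= (kappa * Num.sqrt (K%:R * ln #|A|%:R) + K%:R * varsigma)%:E)%E
  /\
  (forall r : Omega -> 'I_K,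
     uniform_independent_index Pr (history zeta K) r ->
     ('E_Pr[(fun w =>
              avg_cost c h nu (pi (r w) w) - avg_cost c h nu pistar)%R]
        <= (kappa * Num.sqrt (ln #|A|%:R) / Num.sqrt K%:R + varsigma)%:E)%E).
Proof.
move=> kerP stat tmix_lt _ lip [polstar opt] mz mQ vs0 _ kappa0 K1 run crit.
set lam : R := 2 * _ / _ in run.
pose Q k w := Qest (pi k w) (zeta k w).
pose q := nu pistar.
have sq : simplex q by case: (stat _ polstar).
have A0 : (0 < #|A|)%N.
  by have /card_gt0P[s _] := simplex_card_gt0 sq; exact: simplex_card_gt0 (polstar s).
have hcst s p p' : simplex p -> simplex p' -> h s p = h s p'.
  exact: lipschitz0_cst.
have pol k w : policy (pi k w) by move=> s; exact: (run_simplex A0 run).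
have mpi := measurable_run A0 hcst run mQ.
have sF k := history_sigma_algebra zeta k.
have FT k : history zeta k `<=` measurable by exact: history_measurable.
have K0 : 0 < K%:R :> R by rewrite ltr0n.
have /choice[m Hm] : forall k, exists m : S * A -> Omega -> R,
    (forall x, is_cond_exp Pr (history zeta k) (fun w => Q k w x.1 x.2) (m x)) /\
    {ae Pr, forall w, span_seminorm
       (fun x => m x w - diff_Q P c h nu (pi k w) x.1 x.2) <= varsigma}.
  by move=> k; case: (crit k).
(* [H] uses the estimator, which the regret bound controls; [G] uses its conditional mean, which is
   close to the true Q-function. Their integrals agree since the weights are known before step
   [k]. *)
pose H k w := weighted_gap q (fun x => Q k w x.1 x.2) (pi k w) pistar.
pose G k w := weighted_gap q (fun x => m k x w) (pi k w) pistar.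
have HG k : [/\ Pr.-integrable setT (EFin \o H k),
    Pr.-integrable setT (EFin \o G k) &
    (\int[Pr]_w (H k w)%:E = \int[Pr]_w (G k w)%:E)%E].
  have mZ x : measurable_fun (setT : set (g_sigma_algebraType (history zeta k)))
      (fun w => q x.1 * (pi k w x.1 x.2 - pistar x.1 x.2)).
    apply: measurable_funM; first exact: measurable_cst.
    by apply: measurable_funB; [exact: mpi|exact: measurable_cst].
  have Z1 x w : `|q x.1 * (pi k w x.1 x.2 - pistar x.1 x.2)| <= 1.
    rewrite normrM -[leRHS]mulr1; apply: ler_pM => //.
      by rewrite ger0_norm ?sq.1// simplex_le1.
    have := simplex_le1 x.2 (pol k w x.1); have := (pol k w x.1).1 x.2.
    have := simplex_le1 x.2 (polstar x.1); have := (polstar x.1).1 x.2.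
    by rewrite ler_norml => ? ? ? ?; apply/andP; split; lra.
  have := cond_exp_sum (sF k) (FT k) mZ Z1 (Hm k).1.
  have -> : EFin \o H k = (fun w => (\sum_(x : S * A) q x.1 *
      (pi k w x.1 x.2 - pistar x.1 x.2) * Q k w x.1 x.2)%:E).
    by apply/funext => w; rewrite /H /= weighted_gapE.
  have -> : EFin \o G k = (fun w => (\sum_(x : S * A) q x.1 *
      (pi k w x.1 x.2 - pistar x.1 x.2) * m k x w)%:E).
    by apply/funext => w; rewrite /G /= weighted_gapE.
  move=> [? ? eqHG]; split=> //.
  under eq_integral do rewrite /H weighted_gapE.
  by under [RHS]eq_integral do rewrite /G weighted_gapE.
have gap0 k w : 0 <= avg_cost c h nu (pi k w) - avg_cost c h nu pistar.
  by rewrite subr_ge0; apply: opt; exact: pol.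
(* Replacing the true Q-function by the conditional mean costs at most the span of the bias.
   Countably many null sets are merged to cover every [k] at once. *)
have gap_le : {ae Pr, forall w k,
    avg_cost c h nu (pi k w) - avg_cost c h nu pistar <= G k w + varsigma}.
  apply: ae_foralln => k; apply: filterS (Hm k).2 => w spanm.
  rewrite (performance_difference c kerP (pol k w) (stat _ (pol k w))
    (tmix_mixing tmix_lt (pol k w)) polstar (stat _ polstar)); last first.
    by move=> s; apply: hcst; [exact: polstar|exact: pol].
  rewrite -[X in X <= _]/(weighted_gap q
    (fun x => diff_Q P c h nu (pi k w) x.1 x.2) (pi k w) pistar).
  rewrite (weighted_gapB _ _ (fun x => m k x w)) lerD2l.
  by apply: le_trans spanm; apply: span_dual.
have EH : (\int[Pr]_w (\sum_(0 <= k < K) H k w)%:E <=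
    (kappa * Num.sqrt (K%:R * ln #|A|%:R))%:E)%E.
  have lnA0 : 0 <= ln #|A|%:R :> R by rewrite ln_ge0// ler1n.
  have lam0 : 0 <= lam by rewrite divr_ge0 ?mulr_ge0 ?sqrtr_ge0// ltW.
  (* If [ln #|A| = 0] then [lam = 0] and division by it is impossible; but a single action leaves
     only one policy, so [H] vanishes. *)
  move: lnA0; rewrite le_eqVlt => /predU1P[lnA|lnA].
    have A1 : #|A| = 1%N.
      apply/eqP; rewrite eqn_leq A0 andbT leqNgt; apply/negP => A1.
      have : 0 < ln #|A|%:R :> R by rewrite ln_gt0// ltr1n.
      by rewrite -lnA ltxx.
    rewrite -lnA mulr0 sqrtr0 mulr0; under eq_integral => w _.
      rewrite big1; last first.
        move=> k _; apply: big1 => s _.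
        rewrite (simplex_card1 A1 (pol k w s) (polstar s)).
        by rewrite big1 ?mulr0// => a _; rewrite subrr mulr0.
      over.
    by rewrite integral0.
  have lam_gt0 : 0 < lam by rewrite divr_gt0 ?mulr_gt0 ?sqrtr_gt0.
  pose V k w := span_seminorm (fun x : S * A => Q k w x.1 x.2) ^+ 2.
  have iV k : Pr.-integrable setT (fun w => (V k w)%:E).
    by have [_ _ [? [[]]]] := crit k.
  have EV k : (\int[Pr]_w (V k w)%:E <= (kappa ^+ 2)%:E)%E.
    by have [_ _ [v [cv]]] := crit k; exact: (integral_cond_exp_le (sF k) cv).
  have iSV : Pr.-integrable setT (fun w => (\sum_(0 <= k < K) V k w)%:E).
    by apply: integrable_sum_EFin.
  have iSH : Pr.-integrable setT (fun w => (\sum_(0 <= k < K) H k w)%:E).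
    by apply: integrable_sum_EFin => k; case: (HG k).
  have icst := finite_measure_integrable_cst Pr (ln #|A|%:R / lam) measurableT.
  have iZV := integrableZl measurableT (lam / 4) iSV.
  apply: (@le_trans _ _ (\int[Pr]_w ((ln #|A|%:R / lam)%:E +
      (lam / 4)%:E * (\sum_(0 <= k < K) V k w)%:E))%E).
    apply: le_integral => //; first exact: (integrableD measurableT icst iZV).
    move=> w _; rewrite -EFinM -EFinD lee_fin.
    have := run_regret A0 hcst run K w sq polstar lam0.
    rewrite -(ler_pM2l lam_gt0); move=> /le_trans; apply.
    rewrite le_eqVlt; apply/orP; left; apply/eqP; rewrite /V.
    by field; rewrite gt_eqF.
  rewrite integralD// integralZl//.
  rewrite (integral_cst Pr measurableT (ln #|A|%:R / lam)%:E).
  rewrite [X in (_ * X + _)%E]probability_setT mule1.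
  have EV' : (\int[Pr]_w (\sum_(0 <= k < K) V k w)%:E <= (K%:R * kappa ^+ 2)%:E)%E.
    rewrite integral_sum_EFin//; apply: le_trans (lee_sum _ (fun k _ => EV k)) _.
    by rewrite sumEFin sumr_const_nat subn0 mulr_natl.
  apply: (@le_trans _ _ ((ln #|A|%:R / lam)%:E +
      (lam / 4)%:E * (K%:R * kappa ^+ 2)%:E)%E).
    by apply: leeD => //; apply: lee_wpmul2l => //; rewrite lee_fin divr_ge0.
  (* The chosen [lam] balances the two terms: each equals [kappa * x * y / 2], with [x] and [y] the
     square roots introduced next. *)
  rewrite -EFinM -EFinD lee_fin sqrtrM ?ler0n// /lam.
  set x := Num.sqrt (ln _); set y := Num.sqrt _.
  have x0 : x != 0 by rewrite gt_eqF// sqrtr_gt0.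
  have y0 : y != 0 by rewrite gt_eqF// sqrtr_gt0.
  have -> : ln #|A|%:R = x ^+ 2 by rewrite sqr_sqrtr// ltW.
  have -> : K%:R = y ^+ 2 by rewrite sqr_sqrtr// ltW.
  rewrite le_eqVlt; apply/orP; left; apply/eqP.
  by field; rewrite x0 y0 gt_eqF.
have iG k : Pr.-integrable setT (fun w => (G k w + varsigma)%:E).
  have [_ iGk _] := HG k.
  exact: (integrableD measurableT iGk
    (finite_measure_integrable_cst Pr varsigma measurableT)).
have EG : (\int[Pr]_w (\sum_(0 <= k < K) (G k w + varsigma))%:E <=
    (kappa * Num.sqrt (K%:R * ln #|A|%:R) + K%:R * varsigma)%:E)%E.
  have iSG : Pr.-integrable setT (fun w => (\sum_(0 <= k < K) G k w)%:E).
    by apply: integrable_sum_EFin => k; case: (HG k).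
  have icst := finite_measure_integrable_cst Pr (K%:R * varsigma) measurableT.
  under eq_integral => w _.
    rewrite big_split/= sumr_const_nat subn0 -[varsigma *+ K]mulr_natl EFinD.
    over.
  rewrite integralD//.
  rewrite (integral_cst Pr measurableT (K%:R * varsigma)%:E).
  rewrite [X in (_ + _ * X)%E]probability_setT mule1 EFinD leeD2r//.
  apply: le_trans EH; rewrite le_eqVlt; apply/orP; left; apply/eqP.
  rewrite !integral_sum_EFin; last 2 first.
  - by move=> k; case: (HG k).
  - by move=> k; case: (HG k).
  by apply: eq_bigr => k _; case: (HG k).
split.
  (* The cost of [pi k] involves [nu], whose measurability is not established. Optimality makes the
     gaps nonnegative, which is enough for comparison with the integrable bound. *)
  rewrite unlock; apply: le_trans EG; apply: ge0_ae_le_integral_nonmeasurable.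
  - by move=> w; apply: sumr_ge0.
  - exact: integrable_sum_EFin.
  - by apply: filterS gap_le => w gap_w; apply: ler_sum.
move=> r unif_r.
pose ind (j : 'I_K) := \1_(r @^-1` [set j]) : Omega -> R.
(* Independence of r from the history: conditionally on it, {r = j} has
   probability 1 / K. *)
have cind j : is_cond_exp Pr (history zeta K) (ind j) (cst K%:R^-1).
  exact: cond_exp_independent_index.
(* The bound at step [j] is known from the samples before [j], hence from the history up to [K], of
   which [r] is independent. *)
have mG (j : 'I_K) : measurable_fun
    (setT : set (g_sigma_algebraType (history zeta K)))
    (fun w => G j w + varsigma).
  apply: (measurable_fun_history_mono (ltnW (ltn_ord j))).
  apply: measurable_funD; last exact: measurable_cst.
  rewrite (_ : G j = fun w => \sum_(x : S * A) q x.1 *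
      (pi j w x.1 x.2 - pistar x.1 x.2) * m j x w); last first.
    by apply/funext => w; rewrite /G weighted_gapE.
  apply: measurable_sum => x; apply: measurable_funM.
    apply: measurable_funM; first exact: measurable_cst.
    by apply: measurable_funB; [exact: mpi|exact: measurable_cst].
  by case: ((Hm j).1 x).
have iGind (j : 'I_K) : Pr.-integrable setT
    (fun w => ((G j w + varsigma) * ind j w)%:E).
  under eq_fun do rewrite mulrC.
  apply: (@integrable_mul_bounded _ _ _ _ _ _ 1) => //.
    by apply: measurable_indic; case: (unif_r j).
    by move=> w; rewrite /ind indicE; case: (_ \in _); rewrite ?normr1 ?normr0.
  exact: iG.
have iGK (j : 'I_K) : Pr.-integrable setT
    (fun w => ((G j w + varsigma) * K%:R^-1)%:E).
  under eq_fun do rewrite mulrC EFinM.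
  exact: integrableZl.
(* The bound at the random index is written as a sum over all [j] against indicators, of which only
   [j = r w] survives. *)
rewrite unlock; apply: (@le_trans _ _
    (\int[Pr]_w (\sum_(j < K) (G j w + varsigma) * ind j w)%:E)%E).
  apply: ge0_ae_le_integral_nonmeasurable => //.
    exact: integrable_sum_EFin.
  apply: filterS gap_le => w gap_w; rewrite (bigD1 (r w))//= big1 ?addr0.
    by rewrite /ind indicE mem_set// mulr1.
  move=> j jr; rewrite /ind indicE memNset ?mulr0//= => rj.
  by rewrite rj eqxx in jr.
rewrite integral_sum_EFin//.
(* Each indicator is replaced by its conditional expectation [1 / K], which reduces the claim to
   [EG] divided by [K]. *)
under eq_bigr => j _.
  rewrite (cond_exp_mul (sF K) (FT K) (cind j) (mG j) (iGind j) (iGK j)).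
  over.
rewrite -integral_sum_EFin//.
under eq_integral => w _.
  rewrite -mulr_suml -(big_mkord xpredT (fun k => G k w + varsigma)).
  rewrite mulrC EFinM.
  over.
rewrite integralZl//; last exact: integrable_sum_EFin.
apply: le_trans (lee_wpmul2l _ EG) _; first by rewrite lee_fin invr_ge0 ltW.
rewrite -EFinM lee_fin sqrtrM ?ler0n//.
set x := Num.sqrt (ln _); set y := Num.sqrt _.
have y0 : y != 0 by rewrite gt_eqF// sqrtr_gt0.
have -> : K%:R = y ^+ 2 by rewrite sqr_sqrtr// ltW.
by rewrite le_eqVlt; apply/orP; left; apply/eqP; field.
Qed.
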